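(* Let $G$ be a group. The following are equivalent: (i) $G$ is a finite group. (ii) $\widetilde{\mathrm{Gcd}}_R G=0$ for every commutative ring $R$. (iii) $\widetilde{\mathrm{Gcd}}_{\mathbb{Z}} G=0$.
   Context: Rings are associative and unital; modules are left modules unless stated otherwise. A module over a ring $S$ is projectively coresolved Gorenstein flat (PGF) if it is a syzygy (image of a differential) of an acyclic (unbounded) complex $\mathbf{P}$ of projective $S$-modules such that $I\otimes_S\mathbf{P}$ is acyclic for every injective right $S$-module $I$. $\mathrm{PGF\text{-}dim}_S M\in\mathbb{N}\cup\{\infty\}$ is the length of a shortest resolution of $M$ by PGF modules ($\infty$ if there is no finite one); so it is $0$ iff $M$ is PGF. For a commutative ring $R$ and a group $G$, $\widetilde{\mathrm{Gcd}}_R G:=\mathrm{PGF\text{-}dim}_{RG}R$, where $R$ is the trivial $RG$-module. *)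

(* Defs.v *)
From HB Require Import structures.
From mathcomp Require Import all_boot all_order all_algebra.
From mathcomp Require Import boolp classical_sets functions cardinality.
From mathcomp Require Import finmap.
From mathcomp Require Import monalg.

Set Implicit Arguments.
Unset Strict Implicit.
Unset Printing Implicit Defensive.

Import GRing.Theory.

Local Open Scope ring_scope.

(* Additive extension to {malg K[X]} of a family of maps [K -> V] indexed by  *)
(* X.                                                                         *)
Section MalgLift.
Context {X : choiceType} {K V : zmodType}.
Implicit Types (h : X -> K -> V) (a b : {malg K[X]}).

Definition malg_lift h a : V := \sum_(x <- msupp a) h x a@_x.

Definition fiberwise_additive h := forall x, {morph h x : s t / s + t}.

Lemma fiberwise_additive0 h x : fiberwise_additive h -> h x 0 = 0.
Proof. by move=> hD; apply: (@addrI _ (h x 0)); rewrite -hD !addr0. Qed.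

Lemma malg_liftEw h a (d : {fset X}) : fiberwise_additive h ->
  (msupp a `<=` d)%fset -> malg_lift h a = \sum_(x <- d) h x a@_x.
Proof.
move=> hD le_ad; apply: big_fset_incl => // x _ /mcoeff_outdom ->.
exact: fiberwise_additive0.
Qed.

Lemma malg_liftD h : fiberwise_additive h -> {morph malg_lift h : a b / a + b}.
Proof.
move=> hD a b.
rewrite (malg_liftEw hD (msuppD_le a b)).
rewrite (malg_liftEw hD (fsubsetUl (msupp a) (msupp b))).
rewrite (malg_liftEw hD (fsubsetUr (msupp a) (msupp b))).
by rewrite -big_split /=; apply: eq_bigr => x _; rewrite mcoeffD hD.
Qed.

Lemma malg_liftU h x s : fiberwise_additive h ->
  malg_lift h << s *g x >> = h x s.
Proof.
move=> hD; rewrite (malg_liftEw hD (@msuppU_le _ _ x s)) big_seq_fset1.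
by rewrite mcoeffUU.
Qed.

Lemma malg_lift_zmod h : fiberwise_additive h -> zmod_morphism (malg_lift h).
Proof.
move=> hD a b; have E := malg_liftD hD (a - b) b.
by rewrite subrK in E; rewrite E addrK.
Qed.

Lemma malg_additive_ext (f g : {malg K[X]} -> V) :
  {morph f : a b / a + b} -> {morph g : a b / a + b} ->
  (forall s x, f << s *g x >> = g << s *g x >>) -> f =1 g.
Proof.
move=> fD gD fg a.
have f0 : f 0 = 0 by apply: (@addrI _ (f 0)); rewrite -fD !addr0.
have g0 : g 0 = 0 by apply: (@addrI _ (g 0)); rewrite -gD !addr0.
rewrite (monalgE a) (big_morph f fD f0) (big_morph g gD g0).
by apply: eq_bigr => x _; exact: fg.
Qed.

End MalgLift.

(* monalg's own product on {malg R[K]} requires K to be a monoid whose only   *)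
(* unit is 1, hence it is not available when K is a group.                    *)
Definition group_ring (R : comPzRingType) (G : groupType) : Type :=
  {malg R[G]}.

Section GroupRing.
Variables (R : comPzRingType) (G : groupType).

HB.instance Definition _ := GRing.Zmodule.on (group_ring R G).

Implicit Types (a b c : group_ring R G).

Definition gr_one : group_ring R G := << 1 *g 1%g >>.

Definition gr_mul a b : group_ring R G :=
  malg_lift (fun g s => malg_lift (fun h t => << s * t *g (g * h)%g >>) b) a.

Let inner_additive (g : G) (s : R) :
  fiberwise_additive (fun h t => << s * t *g (g * h)%g >> : {malg R[G]}).
Proof. by move=> h t t'; rewrite mulrDr monalgUD. Qed.

Let outer_additive b : fiberwise_additive
  (fun g s => malg_lift (fun h t => << s * t *g (g * h)%g >> : {malg R[G]}) b).
Proof.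
move=> g s s'; rewrite -big_split /=; apply: eq_bigr => h _.
by rewrite mulrDl monalgUD.
Qed.

Lemma gr_mulDl : left_distributive gr_mul +%R.
Proof. by move=> a b c; apply: malg_liftD. Qed.

Lemma gr_mulDr : right_distributive gr_mul +%R.
Proof.
move=> a b c; rewrite /gr_mul /malg_lift -big_split /=.
by apply: eq_bigr => g _; exact: (malg_liftD (@inner_additive g _)).
Qed.

Lemma gr_mulUU s t g h :
  gr_mul << s *g g >> << t *g h >> = << s * t *g (g * h)%g >>.
Proof. by rewrite /gr_mul malg_liftU // malg_liftU. Qed.

Lemma gr_mulA : associative gr_mul.
Proof.
move=> a b c; move: a; apply: malg_additive_ext => [a a'|a a'|s g].
- exact: gr_mulDl.
- by rewrite !gr_mulDl.
move: b; apply: malg_additive_ext => [b b'|b b'|t h].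
- by rewrite gr_mulDl gr_mulDr.
- by rewrite gr_mulDr gr_mulDl.
move: c; apply: malg_additive_ext => [c c'|c c'|u k].
- by rewrite !gr_mulDr.
- exact: gr_mulDr.
by rewrite !gr_mulUU mulrA mulgA.
Qed.

Lemma gr_mul1l : left_id gr_one gr_mul.
Proof.
apply: malg_additive_ext => // [a b|s g]; first exact: gr_mulDr.
by rewrite gr_mulUU mul1r mul1g.
Qed.

Lemma gr_mul1r : right_id gr_one gr_mul.
Proof.
apply: malg_additive_ext => // [a b|s g]; first exact: gr_mulDl.
by rewrite gr_mulUU mulr1 mulg1.
Qed.

HB.instance Definition _ := GRing.Zmodule_isPzRing.Build (group_ring R G)
  gr_mulA gr_mul1l gr_mul1r gr_mulDl gr_mulDr.

Definition augmentation a : R := malg_lift (fun _ s => s) a.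

Lemma augmentationD : {morph augmentation : a b / a + b}.
Proof. exact: malg_liftD. Qed.

Lemma augmentationU s g : augmentation << s *g g >> = s.
Proof. exact: malg_liftU. Qed.

Lemma augmentation1 : augmentation 1 = 1.
Proof. exact: augmentationU. Qed.

Lemma augmentationM : {morph augmentation : a b / a * b}.
Proof.
move=> a b; move: a; apply: malg_additive_ext => [a a'|a a'|s g].
- by rewrite mulrDl augmentationD.
- by rewrite augmentationD mulrDl.
move: b; apply: malg_additive_ext => [b b'|b b'|t h].
- by rewrite mulrDr augmentationD.
- by rewrite augmentationD mulrDr.
by rewrite [_ * _]gr_mulUU !augmentationU.
Qed.

End GroupRing.

(* R with G acting trivially.                                                 *)
Definition trivial_module (R : comPzRingType) (G : groupType) : Type := R.

Section TrivialModule.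
Variables (R : comPzRingType) (G : groupType).

HB.instance Definition _ := GRing.Zmodule.on (trivial_module R G).

Definition trivial_scale (a : group_ring R G) (r : trivial_module R G) :
  trivial_module R G := augmentation a * (r : R).

Lemma trivial_scaleA a b r :
  trivial_scale a (trivial_scale b r) = trivial_scale (a * b) r.
Proof. by rewrite /trivial_scale augmentationM mulrA. Qed.

Lemma trivial_scale1 : left_id 1 trivial_scale.
Proof. by move=> r; rewrite /trivial_scale augmentation1 mul1r. Qed.

Lemma trivial_scaleDr : right_distributive trivial_scale +%R.
Proof. by move=> a r r'; exact: mulrDr. Qed.

Lemma trivial_scaleDl r : {morph trivial_scale^~ r : a b / a + b}.
Proof. by move=> a b; rewrite /trivial_scale augmentationD mulrDl. Qed.

HB.instance Definition _ := GRing.Zmodule_isLmodule.Build (group_ring R G)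
  (trivial_module R G)
  trivial_scaleA trivial_scale1 trivial_scaleDr trivial_scaleDl.

End TrivialModule.

(* Right S-modules are left modules over the converse ring S^c: for           *)
(* [x : M], the right action x . s is [(s : S^c) *: x].                       *)

Section Tensor.
Variable (S : pzRingType).

Definition balanced (M : lmodType S^c) (N : lmodType S) (A : zmodType)
    (phi : M -> N -> A) : Prop :=
  [/\ forall x x' y, phi (x + x') y = phi x y + phi x' y,
      forall x y y', phi x (y + y') = phi x y + phi x y' &
      forall x (s : S) y, phi ((s : S^c) *: x) y = phi x (s *: y)].

Section TensorProduct.
Variables (M : lmodType S^c) (N : lmodType S).

Local Notation pure x y := (<< 1 *g (x, y) >> : {malg (M * N)%type}).

Inductive tensor_relation : {malg (M * N)%type} -> Prop :=
| TensorRel0 : tensor_relation 0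
| TensorRelB u v :
    tensor_relation u -> tensor_relation v -> tensor_relation (u - v)
| TensorRelDl x x' y : tensor_relation (pure (x + x') y - pure x y - pure x' y)
| TensorRelDr x y y' : tensor_relation (pure x (y + y') - pure x y - pure x y')
| TensorRelM x (s : S) y :
    tensor_relation (pure ((s : S^c) *: x) y - pure x (s *: y)).

Definition tensor_relb : {pred {malg (M * N)%type}} :=
  fun u => `[< tensor_relation u >].

Lemma tensor_relb_zmod_closed : zmod_closed tensor_relb.
Proof.
split; first exact/asboolP/TensorRel0.
by move=> u v /asboolP hu /asboolP hv; apply/asboolP/TensorRelB.
Qed.

HB.instance Definition _ :=
  GRing.isZmodClosed.Build _ tensor_relb tensor_relb_zmod_closed.

Definition tensor : Type := {ideal_quot tensor_relb}.
HB.instance Definition _ := GRing.Zmodule.on tensor.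

Definition tensor_pi (u : {malg (M * N)%type}) : tensor :=
  (\pi_({ideal_quot tensor_relb}) u)%qT.

Definition tensor_repr (t : tensor) : {malg (M * N)%type} :=
  repr (t : {ideal_quot tensor_relb}).

Lemma tensor_reprK : cancel tensor_repr tensor_pi.
Proof. exact: reprK. Qed.

Lemma tensor_pi_zmod : zmod_morphism tensor_pi.
Proof. by move=> u v; rewrite /tensor_pi raddfB. Qed.

HB.instance Definition _ :=
  GRing.isZmodMorphism.Build _ _ tensor_pi tensor_pi_zmod.

Lemma tensor_pi_eq u v : tensor_pi u = tensor_pi v <-> tensor_relation (u - v).
Proof.
have E : `[< tensor_relation (u - v) >] = (tensor_pi u == tensor_pi v) :=
  Quotient.idealrBE tensor_relb u v.
by split=> [/eqP|/asboolP h]; [rewrite -E => /asboolP | apply/eqP; rewrite -E].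
Qed.

Definition tens (x : M) (y : N) : tensor := tensor_pi (pure x y).

Definition tensor_lift (A : zmodType) (phi : M -> N -> A) (t : tensor) : A :=
  malg_lift (fun p (z : int) => phi p.1 p.2 *~ z) (tensor_repr t).

End TensorProduct.

Local Notation "x '⊗' y" := (tens x y) (at level 40).

Section TensorUniversal.
Variables (M : lmodType S^c) (N : lmodType S).

Let pi_rel (u v w : {malg (M * N)%type}) : tensor_relation (u - v - w) ->
  tensor_pi u = tensor_pi v + tensor_pi w.
Proof. by rewrite -raddfD => h; apply/tensor_pi_eq; rewrite opprD addrA. Qed.

Lemma tens_balanced : balanced (@tens M N).
Proof.
split=> [x x' y|x y y'|x s y].
- by apply: pi_rel; exact: TensorRelDl.
- by apply: pi_rel; exact: TensorRelDr.
- by apply/tensor_pi_eq; exact: TensorRelM.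
Qed.

Section Lift.
Variables (A : zmodType) (phi : M -> N -> A).
Hypothesis phiB : balanced phi.

Let F := malg_lift (fun (p : M * N) (z : int) => phi p.1 p.2 *~ z).

Let F_fib : fiberwise_additive (fun (p : M * N) (z : int) => phi p.1 p.2 *~ z).
Proof. by move=> p z z'; rewrite mulrzDr. Qed.

Let FB : zmod_morphism F. Proof. exact: malg_lift_zmod. Qed.

Let F1 x y : F << 1 *g (x, y) >> = phi x y.
Proof. by rewrite /F malg_liftU. Qed.

Let F_rel u : tensor_relation u -> F u = 0.
Proof.
have [pDl pDr pM] := phiB.
elim=> [|v w _ v0 _ w0|x x' y|x y y'|x s y].
- by rewrite -[in F 0](subrr 0) FB subrr.
- by rewrite FB v0 w0 subrr.
- by rewrite !FB !F1 pDl (addrC (phi x y)) addrK subrr.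
- by rewrite !FB !F1 pDr (addrC (phi x y)) addrK subrr.
- by rewrite !FB !F1 pM subrr.
Qed.

Let F_pi u v : tensor_pi u = tensor_pi v -> F u = F v.
Proof. by move/tensor_pi_eq/F_rel/eqP; rewrite FB subr_eq0 => /eqP. Qed.

Lemma tensor_lift_tens x y : tensor_lift phi (x ⊗ y) = phi x y.
Proof. by rewrite -F1; apply: F_pi; exact: tensor_reprK. Qed.

Lemma tensor_lift_zmod : zmod_morphism (tensor_lift phi).
Proof.
move=> t u; rewrite /tensor_lift -/F -FB; apply: F_pi.
by rewrite raddfB /= !tensor_reprK.
Qed.

End Lift.

Lemma tensor_additive_ext (A : zmodType) (f g : {additive tensor M N -> A}) :
  (forall x y, f (x ⊗ y) = g (x ⊗ y)) -> f =1 g.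
Proof.
move=> fg t; rewrite -[t]tensor_reprK; move: (tensor_repr t).
have ext (p : M * N) (z : int) : tensor_pi << z *g p >> = (p.1 ⊗ p.2) *~ z.
  by case: p => x y; rewrite /tens -raddfMz -(raddfMz (mkmalgU (x, y))) intz.
apply: malg_additive_ext => [a b|a b|z p]; rewrite ?raddfD //.
by rewrite !ext !raddfMz fg.
Qed.

End TensorUniversal.

Section TensorMap.
Variables (I : lmodType S^c) (N N' : lmodType S) (f : {linear N -> N'}).

Definition tensor_map : tensor I N -> tensor I N' :=
  tensor_lift (fun x y => x ⊗ f y).

Lemma tensor_map_balanced : balanced (fun (x : I) y => x ⊗ f y).
Proof.
have [tDl tDr tM] := tens_balanced I N'.
by split=> [x x' y|x y y'|x s y]; rewrite ?linearD ?linearZ.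
Qed.

Lemma tensor_map_tens x y : tensor_map (x ⊗ y) = x ⊗ f y.
Proof. exact: (tensor_lift_tens tensor_map_balanced). Qed.

HB.instance Definition _ := GRing.isZmodMorphism.Build _ _ tensor_map
  (tensor_lift_zmod tensor_map_balanced).

End TensorMap.
End Tensor.

Arguments tensor_map {S} I {N N'} f t.

Definition exact_at {A B C : zmodType} (f : A -> B) (g : B -> C) : Prop :=
  forall y, g y = 0 <-> exists x, f x = y.

Definition projective_module (S : pzRingType) (P : lmodType S) : Prop :=
  forall (A B : lmodType S) (p : {linear A -> B}) (f : {linear P -> B}),
    (forall b, exists a, p a = b) ->
    exists h : {linear P -> A}, p \o h =1 f.

Definition injective_module (S : pzRingType) (I : lmodType S) : Prop :=
  forall (A B : lmodType S) (i : {linear A -> B}) (f : {linear A -> I}),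
    injective i -> exists h : {linear B -> I}, h \o i =1 f.

(* [n + 1] in a form that computes on the constructors of int, so that        *)
(* dependent families indexed by int can be defined by cases.                 *)
Definition int_succ (n : int) : int :=
  match n with
  | Posz k => Posz k.+1
  | Negz 0 => Posz 0
  | Negz k.+1 => Negz k
  end.

Lemma int_succE n : int_succ n = n + 1.
Proof.
case: n => [k|[|k]] //=; first by rewrite -addn1 PoszD.
by rewrite !NegzE -[k.+2]addn1 PoszD opprD addrNK.
Qed.

(* Unbounded, homologically graded; the equations d d = 0 are part of         *)
(* acyclicity.                                                                *)
Record chain (S : pzRingType) := Chain {
  chain_obj :> int -> lmodType S;
  chain_diff : forall n : int, {linear chain_obj (int_succ n) -> chain_obj n}
}.

Definition acyclic (S : pzRingType) (P : chain S) : Prop :=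
  forall n, exact_at (chain_diff P (int_succ n)) (chain_diff P n).

Definition tensor_acyclic (S : pzRingType) (I : lmodType S^c) (P : chain S) :
    Prop :=
  forall n, exact_at (tensor_map I (chain_diff P (int_succ n)))
                     (tensor_map I (chain_diff P n)).

(* M is isomorphic to the image of f.                                         *)
Definition is_image (S : pzRingType) (M A B : lmodType S)
    (f : {linear A -> B}) : Prop :=
  exists2 j : {linear M -> B}, injective j & range j = range f.

Definition PGF (S : pzRingType) (M : lmodType S) : Prop :=
  exists P : chain S,
    [/\ forall n, projective_module (P n),
        acyclic P,
        forall I : lmodType S^c, injective_module I -> tensor_acyclic I P &
        exists n, is_image M (chain_diff P n)].

(* 0 -> Q n -> ... -> Q 0 -> M -> 0 exact, continued by zero above n.         *)
Definition PGF_resolution (S : pzRingType) (M : lmodType S) (n : nat) : Prop :=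
  exists (Q : nat -> lmodType S) (d : forall k, {linear Q k.+1 -> Q k})
         (e : {linear Q 0%N -> M}),
    [/\ forall k, (k <= n)%N -> PGF (Q k),
        forall k, (n < k)%N -> forall x : Q k, x = 0,
        forall y, exists x, e x = y,
        exact_at (d 0%N) e &
        forall k, exact_at (d k.+1) (d k)].

(* None stands for infinity.                                                  *)
Definition PGF_dim (S : pzRingType) (M : lmodType S) : option nat :=
  if pselect (exists n, `[< PGF_resolution M n >]) is left ex_res
  then Some (ex_minn ex_res) else None.

Definition Gcd_tilde (R : comPzRingType) (G : groupType) : option nat :=
  PGF_dim (trivial_module R G : lmodType (group_ring R G)).

(* Main.v *)
(* If the trivial module R (R nonzero) is PGF, it embeds in a projective,     *)
(* hence in a free, RG-module; a nonzero coordinate of the image of 1 is a    *)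
(* nonzero G-invariant element of RG, whose finite support is all of G.       *)
(* Conversely, for G finite, let F(N) be the functions G -> N with diagonal   *)
(* action. Iterating summation F(N) -> N and constants N -> F(N) from N = R   *)
(* gives a complete resolution of R by the projectives F^n(R), which is       *)
(* contractible over R. Every injective right module I carries an R-linear    *)
(* phi with sum_g phi(x g^-1) g = x, because I is a summand of the functions  *)
(* G -> I; averaging the contraction h into                                   *)
(*   x (x) p |-> sum_g phi(x g^-1) (x) h(g p)                                 *)
(* makes it well defined on the tensor product with I over RG.                *)
From HB Require Import structures.
Require Import Defs.
From mathcomp Require Import all_boot all_order all_algebra.
From mathcomp Require Import boolp classical_sets functions cardinality.
From mathcomp Require Import finmap.
From mathcomp Require Import monalg.

Set Implicit Arguments.
Unset Strict Implicit.
Unset Printing Implicit Defensive.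

Import GRing.Theory.

Local Open Scope ring_scope.

(** By [PGF_dim0], dimension zero means that the trivial module is PGF, so the cycle (i), (ii),
    (iii), (i) rests on two facts. [trivial_PGF_finite]: over a nonzero R, a PGF trivial module
    embeds in a projective module, and a functional ([projective_torsionless]) carries the image of
    1 to a nonzero invariant of RG, which forces G to be finite ([invariant_finite]). [trivial_PGF]:
    for finite G the complex [tate] has projective terms ([diag_projective]), has R as the image of
    its norm map, and is contracted over R by [tate_htpy]. The contraction gives acyclicity;
    averaged with the trace of [injective_trace], it also gives acyclicity after tensoring with an
    injective module ([contraction_tensor_acyclic]). *)

Definition to_linear (S : pzRingType) (M N : lmodType S) (f : M -> N)
    (fL : linear f) : {linear M -> N} :=
  HB.pack f (GRing.isLinear.Build S M N *:%R f fL).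

Definition to_additive (M N : zmodType) (f : M -> N) (fB : zmod_morphism f) :
    {additive M -> N} :=
  HB.pack f (GRing.isZmodMorphism.Build M N f fB).

Lemma morphD_zmod (M N : zmodType) (f : M -> N) :
  {morph f : x y / x + y} -> zmod_morphism f.
Proof.
by move=> fD x y; apply: (@addIr _ (f y)); rewrite -fD !subrK.
Qed.

Lemma morphD_sum (M N : zmodType) (f : M -> N) (I : Type) (r : seq I)
    (F : I -> M) : {morph f : x y / x + y} ->
  f (\sum_(i <- r) F i) = \sum_(i <- r) f (F i).
Proof. by move=> /morphD_zmod fB; exact: (raddf_sum (to_additive fB)). Qed.

(** * Diagonal actions of RG on functions from G to a module *)

(* The common pattern of the left and right diagonal actions on G -> N; [u]   *)
(* is the identity seen as a map into RG or into its converse ring.           *)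
Section TwistedScale.
Variables (R : comPzRingType) (G : groupType) (T : pzRingType).
Variables (N : lmodType T) (u : group_ring R G -> T) (act : G -> G -> G).
Hypothesis uD : {morph u : a b / a + b}.

Definition twisted_scale (a : group_ring R G) (f : G -> N) : G -> N :=
  fun x => malg_lift (fun g r => u << r *g g >> *: f (act g x)) a.

Let fib (f : G -> N) x :
  fiberwise_additive (fun g r => u << r *g g >> *: f (act g x)).
Proof. by move=> g r r'; rewrite monalgUD uD scalerDl. Qed.

Lemma twisted_scaleU r g f x :
  twisted_scale << r *g g >> f x = u << r *g g >> *: f (act g x).
Proof. exact: (malg_liftU _ _ (fib f x)). Qed.

Lemma twisted_scaleDl f : {morph twisted_scale^~ f : a b / a + b}.
Proof. by move=> a b; apply/funext => x; exact: (malg_liftD (fib f x)). Qed.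

Lemma twisted_scaleDr : right_distributive twisted_scale +%R.
Proof.
move=> a f f'; apply/funext => x; rewrite /twisted_scale /malg_lift.
rewrite [RHS](_ : _ = \sum_(g <- msupp a) u << a@_g *g g >> *: f (act g x) +
   \sum_(g <- msupp a) u << a@_g *g g >> *: f' (act g x)) //.
by rewrite -big_split /=; apply: eq_bigr => g _; rewrite -scalerDr.
Qed.

Lemma twisted_scale1 : u 1 = 1 -> (forall x, act 1%g x = x) ->
  left_id 1 twisted_scale.
Proof.
by move=> u1 act1 f; apply/funext => x; rewrite twisted_scaleU act1 u1 scale1r.
Qed.

(** [m] and [op] are the products of RG and G in the order seen by the action: the opposite ones for
    right modules. Both sides are additive in [a] and [b], so monomials suffice. *)
Lemma twisted_scaleA (m : group_ring R G -> group_ring R G -> group_ring R G)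
    (op : G -> G -> G) :
  left_distributive m +%R -> right_distributive m +%R ->
  (forall a b, u (m a b) = u a * u b) ->
  (forall r s g h, m << r *g g >> << s *g h >> = << r * s *g op g h >>) ->
  (forall g h x, act (op g h) x = act h (act g x)) ->
  forall a b f, twisted_scale a (twisted_scale b f) = twisted_scale (m a b) f.
Proof.
move=> mDl mDr um mU actM a b f; move: a.
apply: (@malg_additive_ext G R (G -> N)) => [a a'|a a'|r g].
- exact: twisted_scaleDl.
- by rewrite mDl; exact: twisted_scaleDl.
move: b; apply: (@malg_additive_ext G R (G -> N)) => [b b'|b b'|s h].
- by rewrite twisted_scaleDl twisted_scaleDr.
- by rewrite mDr; exact: twisted_scaleDl.
apply/funext => x.
by rewrite !twisted_scaleU mU twisted_scaleU actM scalerA -um mU.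
Qed.

End TwistedScale.

Section Modules.
Variables (R : comPzRingType) (G : groupType).
Local Notation S := (group_ring R G).
Local Notation gr r g := (<< r *g g >> : group_ring R G).

Lemma grM r s g h : gr r g * gr s h = gr (r * s) (g * h)%g.
Proof. exact: gr_mulUU. Qed.

Lemma gr_linear (M N : lmodType S) (f : M -> N) :
  {morph f : x y / x + y} -> (forall r g x, f (gr r g *: x) = gr r g *: f x) ->
  linear f.
Proof.
move=> fD fU a x y; rewrite fD; congr (_ + _); move: a.
apply: malg_additive_ext => [a b|a b|r g]; last exact: fU.
  by rewrite scalerDl fD.
by rewrite scalerDl.
Qed.

Lemma gr_linear_op (M N : lmodType S^c) (f : M -> N) :
  {morph f : x y / x + y} ->
  (forall r g x, f ((gr r g : S^c) *: x) = (gr r g : S^c) *: f x) ->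
  linear f.
Proof.
move=> fD fU a x y; rewrite fD; congr (_ + _); move: a.
apply: malg_additive_ext => [a b|a b|r g].
- by rewrite (scalerDl x (a : S^c)) fD.
- by rewrite (scalerDl (f x) (a : S^c)).
exact: fU.
Qed.

(** For finite G this is isomorphic to the module induced from the underlying R-module of N, which
    is the source of its projectivity. *)
Definition diag (N : lmodType S) : Type := G -> N.
HB.instance Definition _ N := GRing.Zmodule.copy (diag N) (G -> N).

Definition diag_scale N (a : S) (f : diag N) : diag N :=
  twisted_scale id (fun g x => g^-1 * x)%g a f.

Lemma diag_scaleA N a b (f : diag N) :
  diag_scale a (diag_scale b f) = diag_scale (a * b) f.
Proof.
apply: (@twisted_scaleA R G S N id _ _ _ (fun g h => g * h)%g) => //.
- exact: gr_mulDl.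
- exact: gr_mulDr.
- by move=> *; exact: gr_mulUU.
- by move=> g h x; rewrite invgM mulgA.
Qed.

Lemma diag_scale1 N : left_id 1 (@diag_scale N).
Proof. by apply: twisted_scale1 => // x; rewrite invg1 mul1g. Qed.

Lemma diag_scaleDr N : right_distributive (@diag_scale N) +%R.
Proof. exact: twisted_scaleDr. Qed.

Lemma diag_scaleDl N f : {morph (@diag_scale N)^~ f : a b / a + b}.
Proof. exact: twisted_scaleDl. Qed.

HB.instance Definition _ N := GRing.Zmodule_isLmodule.Build S (diag N)
  (@diag_scaleA N) (@diag_scale1 N) (@diag_scaleDr N) (@diag_scaleDl N).

Lemma diag_scaleU N r g (f : diag N) x :
  (gr r g *: f) x = gr r g *: f (g^-1 * x)%g.
Proof. exact: (twisted_scaleU (u := id)). Qed.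

Definition diag_op (I : lmodType S^c) : Type := G -> I.
HB.instance Definition _ I := GRing.Zmodule.copy (diag_op I) (G -> I).

Definition diag_op_scale I (a : S^c) (f : diag_op I) : diag_op I :=
  twisted_scale (id : S -> S^c) (fun g x => x * g^-1)%g a f.

Lemma diag_op_scaleA I a b (f : diag_op I) :
  diag_op_scale a (diag_op_scale b f) = diag_op_scale (a * b) f.
Proof.
apply: (@twisted_scaleA R G S^c I id _ _ (fun a b => gr_mul b a)
  (fun g h => h * g)%g) => //.
- by move=> c d e; exact: gr_mulDr.
- by move=> c d e; exact: gr_mulDl.
- by move=> r s g h; rewrite gr_mulUU mulrC.
- by move=> g h x; rewrite invgM mulgA.
Qed.

Lemma diag_op_scale1 I : left_id 1 (@diag_op_scale I).
Proof. by apply: twisted_scale1 => // x; rewrite invg1 mulg1. Qed.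

Lemma diag_op_scaleDr I : right_distributive (@diag_op_scale I) +%R.
Proof. exact: twisted_scaleDr. Qed.

Lemma diag_op_scaleDl I f : {morph (@diag_op_scale I)^~ f : a b / a + b}.
Proof. exact: twisted_scaleDl. Qed.

HB.instance Definition _ I := GRing.Zmodule_isLmodule.Build S^c (diag_op I)
  (@diag_op_scaleA I) (@diag_op_scale1 I) (@diag_op_scaleDr I)
  (@diag_op_scaleDl I).

Lemma diag_op_scaleU I r g (f : diag_op I) x :
  ((gr r g : S^c) *: f) x = (gr r g : S^c) *: f (x * g^-1)%g.
Proof. exact: (twisted_scaleU (u := (id : S -> S^c))). Qed.

End Modules.

(** * Finite G: sums, pulses and equivariant maps *)

Section FiniteGroup.
Variables (R : comPzRingType) (G : groupType) (X : {fset G}).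
Hypothesis XG : forall g, g \in X.
Local Notation S := (group_ring R G).
Local Notation gr r g := (<< r *g g >> : group_ring R G).

Lemma sum_mull (V : nmodType) (F : G -> V) g :
  \sum_(x <- X) F (g * x)%g = \sum_(x <- X) F x.
Proof.
rewrite -(big_map (fun x => g * x)%g xpredT F); apply: perm_big.
apply: uniq_perm => [||x]; rewrite ?map_inj_uniq //; first exact: mulgI.
by rewrite XG; apply/mapP; exists (g^-1 * x)%g; rewrite // mulVKg.
Qed.

Lemma sum_mulr (V : nmodType) (F : G -> V) g :
  \sum_(x <- X) F (x * g)%g = \sum_(x <- X) F x.
Proof.
rewrite -(big_map (fun x => x * g)%g xpredT F); apply: perm_big.
apply: uniq_perm => [||x]; rewrite ?map_inj_uniq //; first exact: mulIg.
by rewrite XG; apply/mapP; exists (x * g^-1)%g; rewrite // mulgVK.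
Qed.

Definition pulse (N : zmodType) (y : G) (v : N) : G -> N :=
  fun x => if x == y then v else 0.

Lemma pulseD (N : zmodType) y (v w : N) :
  pulse y (v + w) = pulse y v + pulse y w :> (G -> N).
Proof.
apply/funext => x; rewrite [RHS](_ : _ = pulse y v x + pulse y w x) // /pulse.
by case: ifP => //; rewrite addr0.
Qed.

Lemma sum_pulse (N : zmodType) (f : G -> N) :
  \sum_(x <- X) pulse x (f x) = f.
Proof.
apply/funext => y; rewrite fct_sumE (big_fsetD1 y) ?XG //= /pulse eqxx.
rewrite big_seq big1 ?addr0 // => x.
by rewrite !inE eq_sym => /andP[/negPf ->].
Qed.

Lemma total_pulse (N : zmodType) y (v : N) : \sum_(x <- X) pulse y v x = v.
Proof.
rewrite (big_fsetD1 y) ?XG //= /pulse eqxx big_seq big1 ?addr0 // => x.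
by rewrite !inE => /andP[/negPf ->].
Qed.

Lemma diag_scale_pulse (N : lmodType S) r g y (v : N) :
  gr r g *: (pulse y v : diag N) = pulse (g * y)%g (gr r g *: v).
Proof.
apply/funext => x; rewrite diag_scaleU /pulse.
rewrite -(inj_eq (@mulgI _ g)) mulVKg.
by case: ifP => //; rewrite scaler0.
Qed.

Lemma diag_op_scale_pulse (I : lmodType S^c) r g y (v : I) :
  (gr r g : S^c) *: (pulse y v : diag_op I) =
  pulse (y * g)%g ((gr r g : S^c) *: v).
Proof.
apply/funext => x; rewrite diag_op_scaleU /pulse.
rewrite -(inj_eq (@mulIg _ g)) mulgVK.
by case: ifP => //; rewrite scaler0.
Qed.

Section Maps.
Variables (N N' : lmodType S) (u : {linear N -> N'}).

Lemma total_linear : linear (fun f : diag N => \sum_(x <- X) f x : N).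
Proof.
apply: gr_linear => [f f'|r g f]; first by rewrite -big_split.
rewrite scaler_sumr -[RHS](sum_mull _ g^-1).
by apply: eq_bigr => x _; rewrite diag_scaleU.
Qed.

Lemma const_linear : linear ((fun v _ => v) : N -> diag N).
Proof.
by apply: gr_linear => // r g v; apply/funext => x; rewrite diag_scaleU.
Qed.

Lemma comp_linear : linear ((fun f x => u (f x)) : diag N -> diag N').
Proof.
apply: gr_linear => [f f'|r g f]; apply/funext => x.
  exact: raddfD.
by rewrite !diag_scaleU linearZ.
Qed.

Definition total := to_linear total_linear.
Definition const := to_linear const_linear.
Definition diag_map := to_linear comp_linear.

Lemma constE v x : const v x = v. Proof. by []. Qed.
Lemma diag_mapE f x : diag_map f x = u (f x). Proof. by []. Qed.

End Maps.

(** * Projectivity over R and over RG *)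

(* R-linearity, R acting on RG-modules through R -> RG.                       *)
Definition base_linear (M N : lmodType S) (f : M -> N) : Prop :=
  {morph f : x y / x + y} /\
  forall r x, f (gr r 1%g *: x) = gr r 1%g *: f x.

(* Characterizes the RG-modules whose underlying R-module is projective.      *)
Definition base_projective (N : lmodType S) : Prop :=
  forall (A B : lmodType S) (p : {linear A -> B}) (f : N -> B),
    (forall b, exists a, p a = b) -> base_linear f ->
    exists2 h : N -> A, base_linear h & p \o h =1 f.

Lemma trivial_gr_scale r g (s : trivial_module R G) :
  gr r g *: s = r * (s : R) :> R.
Proof. by rewrite [LHS]/(augmentation _ * _) augmentationU. Qed.

(** R is free on 1 over itself, so a preimage of [f 1] determines a lift. *)
Lemma trivial_base_projective :
  base_projective (trivial_module R G : lmodType S).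
Proof.
move=> A B p f psurj [fD fZ]; have [a pa] := psurj (f (1 : R)).
exists (fun r : trivial_module R G => gr (r : R) 1%g *: a).
  split=> [r s|r s]; first by rewrite /= -scalerDl monalgUD.
  by rewrite trivial_gr_scale scalerA grM mulg1.
move=> r /=; rewrite linearZ /= pa -fZ; congr f.
by rewrite trivial_gr_scale mulr1.
Qed.

(** Over R this is a finite direct sum of copies of N, so lifts chosen on the pulses at each point
    add up. *)
Lemma diag_base_projective (N : lmodType S) :
  base_projective N -> base_projective (diag N).
Proof.
move=> projN A B p f psurj [fD fZ].
have /choice[h hP] : forall x, exists h : N -> A,
    base_linear h /\ p \o h =1 f \o (pulse x : N -> diag N).
  move=> x; have [|h] := projN A B p (f \o (pulse x : N -> diag N)) psurj.
    split=> [v w|r v]; first by rewrite /= pulseD fD.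
    by rewrite /= -fZ diag_scale_pulse mul1g.
  by move=> hl ph; exists h.
exists (fun f' => \sum_(x <- X) h x (f' x)).
  split=> [f1 f2|r f1].
    by rewrite -big_split; apply: eq_bigr => x _; rewrite /= -(hP x).1.1.
  rewrite scaler_sumr; apply: eq_bigr => x _.
  by rewrite diag_scaleU invg1 mul1g (hP x).1.2.
move=> f' /=; rewrite raddf_sum.
rewrite (eq_bigr (fun x => f (pulse x (f' x)))) => [|x _]; last exact: (hP x).2.
by rewrite -(morphD_sum _ _ fD) (sum_pulse f').
Qed.

(** RG-maps out of [diag N] correspond to R-maps on the functions supported at 1, so an R-linear
    lift there extends equivariantly. *)
Lemma diag_projective (N : lmodType S) :
  base_projective N -> projective_module (diag N).
Proof.
move=> projN A B p f psurj.
have [|h [hD hZ] ph] := projN A B p (f \o (pulse 1%g : N -> diag N)) psurj.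
  split=> [v w|r v]; first by rewrite /= pulseD raddfD.
  by rewrite /= -linearZ /= diag_scale_pulse mul1g.
(* The part of f' at x is the translate by x of the pulse at 1 with value x^-1 f'(x). *)
pose h' (f' : diag N) : A :=
  \sum_(x <- X) gr 1 x *: h (gr 1 x^-1%g *: f' x).
have h'L : linear h'.
  apply: gr_linear => [f1 f2|r g f'].
    rewrite -big_split; apply: eq_bigr => x _.
    by rewrite /= scalerDr hD scalerDr.
  rewrite scaler_sumr -[LHS](sum_mull _ g); apply: eq_bigr => x _.
  rewrite diag_scaleU mulKg !scalerA !grM mul1r mulr1 invgM mulgVK.
  rewrite -[r in LHS]mulr1 -[x^-1%g in LHS]mul1g -grM -scalerA hZ scalerA grM.
  by rewrite mul1r mulg1.
exists (to_linear h'L) => f' /=; rewrite linear_sum.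
rewrite -[in RHS](sum_pulse f') linear_sum; apply: eq_bigr => x _.
rewrite linearZ /= [p _]ph /= -linearZ /= diag_scale_pulse mulg1.
by rewrite scalerA grM mulgV mulr1 scale1r.
Qed.


(** * Contractions over R and tensoring with injectives *)

(** I embeds in [diag_op I] as the constants, and injectivity provides a retraction h; [phi] is h on
    pulses at 1. A constant is the sum of its pulses, which are translates of pulses at 1, so the
    trace of [phi] is the identity. *)
Lemma injective_trace (I : lmodType S^c) : injective_module I ->
  exists phi : I -> I,
    [/\ {morph phi : x y / x + y},
        forall r x, phi ((gr r 1%g : S^c) *: x) = (gr r 1%g : S^c) *: phi x &
        forall x, \sum_(g <- X)
          (gr 1 g : S^c) *: phi ((gr 1 g^-1%g : S^c) *: x) = x].
Proof.
move=> injI.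
have cL : linear ((fun v _ => v) : I -> diag_op I).
  by apply: gr_linear_op => // r g v; apply/funext => x; rewrite diag_op_scaleU.
have idL : linear (@idfun I) by [].
have [|h hK] := injI _ _ (to_linear cL) (to_linear idL).
  by move=> v w /(congr1 (fun f => f 1%g)).
exists (fun x => h (pulse 1%g x)); split=> [x y|r x|x].
- by rewrite pulseD raddfD.
- by rewrite -linearZ diag_op_scale_pulse mulg1.
rewrite -[RHS]hK /= -[X in h X](sum_pulse (fun=> x)) linear_sum.
apply: eq_bigr => g _; rewrite -linearZ diag_op_scale_pulse mul1g scalerA.
by rewrite [_ * _]grM mulVg mul1r scale1r.
Qed.

Section Contraction.
Variables (P : chain S) (h : forall n, P n -> P (int_succ n)).
Hypothesis hR : forall n, base_linear (@h n).
Hypothesis dd : forall n x,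
  chain_diff P n (chain_diff P (int_succ n) x) = 0.
Hypothesis dh : forall n x,
  chain_diff P (int_succ n) (h x) + h (chain_diff P n x) = x.

Lemma contraction_acyclic : acyclic P.
Proof.
move=> n y; split=> [dy|[x <-]]; last exact: dd.
have h0 : h (0 : P n) = 0.
  by apply: (@addrI _ (h (0 : P n))); rewrite -(hR n).1 !addr0.
by exists (h y); have := dh y; rewrite dy h0 addr0.
Qed.

Section TensorContraction.
Variables (I : lmodType S^c) (phi : I -> I).
Hypothesis phiD : {morph phi : x y / x + y}.
Hypothesis phiR : forall r x,
  phi ((gr r 1%g : S^c) *: x) = (gr r 1%g : S^c) *: phi x.
Hypothesis phi_trace : forall x, \sum_(g <- X)
  (gr 1 g : S^c) *: phi ((gr 1 g^-1%g : S^c) *: x) = x.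

(** [h] is only R-linear, so [x] tensor [h p] need not be balanced over RG; averaging against [phi]
    repairs this. *)
Definition tensor_htpy_fun n (x : I) (p : P n) : tensor I (P (int_succ n)) :=
  \sum_(g <- X) tens (phi ((gr 1 g^-1%g : S^c) *: x)) (h (gr 1 g *: p)).

Lemma tensor_htpy_balanced n : balanced (@tensor_htpy_fun n).
Proof.
have [tDl tDr tM] := tens_balanced I (P (int_succ n)).
have HDl x x' p : tensor_htpy_fun (x + x') p =
    tensor_htpy_fun x p + tensor_htpy_fun x' p :> tensor I (P (int_succ n)).
  by rewrite -big_split; apply: eq_bigr => g _; rewrite /= scalerDr phiD tDl.
have HDr x p p' : tensor_htpy_fun x (p + p') =
    tensor_htpy_fun x p + tensor_htpy_fun x p' :> tensor I (P (int_succ n)).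
  by rewrite -big_split; apply: eq_bigr => g _;
    rewrite /= scalerDr (hR n).1 tDr.
split=> // x s p; move: s.
apply: malg_additive_ext => [a b|a b|r k].
- by rewrite (scalerDl x (a : S^c)) HDl.
- by rewrite scalerDl HDr.
(* Replacing g by gk cancels k in the first factor and moves it to the second; r then crosses by
   R-linearity. *)
rewrite /tensor_htpy_fun -[LHS](sum_mulr _ k); apply: eq_bigr => g _.
rewrite !scalerA [X in X *: x]grM grM mulr1 mul1r invgM mulVKg.
have -> : ((gr r g^-1%g : S^c) *: x) =
    (gr r 1%g : S^c) *: ((gr 1 g^-1%g : S^c) *: x).
  by rewrite scalerA [X in _ = X *: x]grM mul1r mulg1.
by rewrite phiR tM -(hR n).2 scalerA grM mulr1 mul1g.
Qed.

Definition tensor_htpy n :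
    {additive tensor I (P n) -> tensor I (P (int_succ n))} :=
  to_additive (tensor_lift_zmod (@tensor_htpy_balanced n)).

(** On pure tensors, [dh] turns each summand into phi(x g^-1) ⊗ g p; moving g across leaves the
    trace of [phi] at x, which is x. *)
Lemma tensor_htpyP n t :
  tensor_map I (chain_diff P (int_succ n)) (tensor_htpy (int_succ n) t) +
  tensor_htpy n (tensor_map I (chain_diff P n) t) = t.
Proof.
have [tDl tDr tM] := tens_balanced I (P (int_succ n)).
move: t; apply: (tensor_additive_ext (f :=
  (tensor_map I (chain_diff P (int_succ n)) \o tensor_htpy (int_succ n)) \+
  (tensor_htpy n \o tensor_map I (chain_diff P n))) (g := idfun)) => x p /=.
rewrite tensor_map_tens !(tensor_lift_tens (@tensor_htpy_balanced _)).
rewrite /tensor_htpy_fun raddf_sum -big_split /=.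
under eq_bigr => g _.
  rewrite tensor_map_tens -linearZ -tDr dh -tM.
  over.
by rewrite -(morphD_sum _ _ (fun a b => tDl a b p)) phi_trace.
Qed.

Lemma contraction_tensor_acyclic_trace : tensor_acyclic I P.
Proof.
move=> n y; split=> [dy|[x <-]].
  by exists (tensor_htpy _ y); have := tensor_htpyP y; rewrite dy raddf0 addr0.
move: x; apply: (tensor_additive_ext (f := tensor_map I (chain_diff P n) \o
  tensor_map I (chain_diff P (int_succ n))) (g := \0)) => x p /=.
have [_ tDr _] := tens_balanced I (P n).
rewrite !tensor_map_tens dd.
by apply: (@addrI _ (tens x (0 : P n))); rewrite -tDr !addr0.
Qed.

End TensorContraction.

Lemma contraction_tensor_acyclic (I : lmodType S^c) :
  injective_module I -> tensor_acyclic I P.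
Proof.
case/injective_trace=> phi [phiD phiR phi_trace].
exact: contraction_tensor_acyclic_trace phiD phiR phi_trace.
Qed.

End Contraction.

(** * The complete resolution of the trivial module *)

Fixpoint tower (n : nat) : lmodType S :=
  if n is k.+1 then diag (tower k) else trivial_module R G.

(* bd = total - F(bd), so that the pulse at 1 is a contraction; dually,       *)
(* cobd = const - F(cobd) is contracted by evaluation at 1.                   *)
Fixpoint bd (n : nat) : {linear tower n.+1 -> tower n} :=
  if n is k.+1 then total (tower k.+1) \- diag_map (bd k)
  else total (tower 0).

Fixpoint cobd (n : nat) : {linear tower n -> tower n.+1} :=
  if n is k.+1 then const (tower k.+1) \- diag_map (cobd k)
  else const (tower 0).

Lemma bdSE n (f : tower n.+2) :
  bd n.+1 f = total (tower n.+1) f - diag_map (bd n) f.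
Proof. by []. Qed.

Lemma cobdSE n (f : tower n.+1) x : cobd n.+1 f x = f - cobd n (f x).
Proof. by []. Qed.

Lemma bd_total n (f : tower n.+2) :
  bd n (total (tower n.+1) f) = total (tower n) (diag_map (bd n) f).
Proof. exact: linear_sum. Qed.

(** Summation is natural, so the two totals cancel; what remains is the same composite one level
    down, applied pointwise. *)
Lemma bd_bd n (f : tower n.+2) : bd n (bd n.+1 f) = 0.
Proof.
have bdB m (v w : tower m.+1) : bd m (v - w) = bd m v - bd m w.
  exact: raddfB.
elim: n f => [|n IHn] f; rewrite (bdSE f) bdB bd_total; first exact: subrr.
rewrite (bdSE (diag_map (bd n.+1) f)).
rewrite [X in _ - (_ - X)](_ : _ = 0) ?subr0 ?subrr //.
by apply/funext => x; exact: IHn.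
Qed.

Lemma cobd_cobd n (f : tower n) : cobd n.+1 (cobd n f) = 0.
Proof.
have cobdB m (v w : tower m) : cobd m (v - w) = cobd m v - cobd m w.
  exact: raddfB.
elim: n f => [|n IHn] f; apply/funext => x; rewrite cobdSE.
  by rewrite constE subrr.
(* By linearity the two terms combine into [cobd] applied twice to [f x]. *)
by rewrite -cobdB cobdSE opprB addrC subrK; exact: IHn.
Qed.

Lemma tower_base_projective n : base_projective (tower n).
Proof.
elim: n => [|n IHn]; first exact: trivial_base_projective.
exact: diag_base_projective.
Qed.

(** Degrees 0 and -1 both carry [tower 1]; R itself is not placed in any degree and appears as the
    image of [norm_map] between these two. *)
Definition tate_obj (n : int) : lmodType S :=
  match n with Posz k => tower k.+1 | Negz k => tower k.+1 end.

Definition norm_map : {linear tower 1 -> tower 1} := cobd 0 \o bd 0.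

Definition tate_diff (n : int) :
    {linear tate_obj (int_succ n) -> tate_obj n} :=
  match n with
  | Posz k => bd k.+1
  | Negz 0 => norm_map
  | Negz k.+1 => cobd k.+1
  end.

Definition tate : chain S := Chain tate_diff.

(** In degree -1 evaluation at 1 and the pulse at 1 are spliced through R. *)
Definition tate_htpy (n : int) : tate_obj n -> tate_obj (int_succ n) :=
  match n with
  | Posz k => pulse 1%g
  | Negz 0 => fun f => pulse 1%g (f 1%g)
  | Negz k.+1 => fun f => f 1%g
  end.

Lemma bd_pulse n (f : tower n.+1) :
  bd n.+1 (pulse 1%g f) + pulse 1%g (bd n f) = f.
Proof.
rewrite bdSE [total _ _]total_pulse.
rewrite [X in _ - X + _](_ : _ = pulse 1%g (bd n f)).
  by rewrite subrK.
apply/funext => x; rewrite diag_mapE /pulse.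
by case: ifP; rewrite ?linear0.
Qed.

Lemma tate_htpyP n x :
  tate_diff (int_succ n) (tate_htpy x) + tate_htpy (tate_diff n x) = x.
Proof.
case: n x => [k|[|[|k]]] x.
- exact: (@bd_pulse k.+1).
(* The norm of x has value [bd 0 x] at 1, which turns this case into the pulse identity. *)
- exact: (@bd_pulse 0).
(* The norm of a pulse is the constant function with the same value. *)
- rewrite [X in X + _](_ : _ = cobd 0 (bd 0 (pulse 1%g (x 1%g)))) //.
  by rewrite [bd 0 _]total_pulse [X in _ + X](@cobdSE 0) addrC subrK.
- by rewrite [X in _ + X](@cobdSE k.+1) addrC subrK.
Qed.

Lemma tate_htpy_linear n : base_linear (@tate_htpy n).
Proof.
(case: n => [k|[|k]]; split) => //= [f f'|r f|f f'|r f|r f].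
- exact: pulseD.
- by rewrite diag_scale_pulse mul1g.
- exact: pulseD.
- by rewrite diag_scale_pulse diag_scaleU invg1 !mul1g.
- by rewrite diag_scaleU invg1 mul1g.
Qed.

Lemma tate_diffK n x : tate_diff n (tate_diff (int_succ n) x) = 0.
Proof.
case: n x => [k|[|[|k]]] x.
- exact: bd_bd.
- exact: etrans (congr1 (cobd 0) (@bd_bd 0 x)) (linear0 _).
- exact: (cobd_cobd (bd 0 x)).
- exact: cobd_cobd.
Qed.

Lemma trivial_PGF : PGF (trivial_module R G : lmodType S).
Proof.
exists tate; split.
- by case=> k; apply: diag_projective; exact: tower_base_projective.
- exact: (@contraction_acyclic tate tate_htpy tate_htpy_linear tate_diffK
    tate_htpyP).
- exact: (@contraction_tensor_acyclic tate tate_htpy tate_htpy_linear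
    tate_diffK tate_htpyP).
(* R embeds as the constants; they fill the image of the norm because r is the total of its pulse at
   1. *)
exists (Negz 0), (cobd 0); first by move=> r s /(congr1 (fun f => f 1%g)).
apply/seteqP; split=> [_ [r _ <-]|_ [f _ <-]].
  by exists (pulse 1%g r) => //=; congr (const _ _); exact: total_pulse.
by exists (bd 0 f).
Qed.

End FiniteGroup.

(** * Dimension zero *)

Section PGFDimension.
Variable S : pzRingType.

(** Empty matrices serve as the zero module. *)
Definition trunc_obj (M : lmodType S) (k : nat) : lmodType S :=
  if k is 0 then M else 'M[S]_(0, 0).

Lemma PGF_resolution0 (M : lmodType S) : PGF_resolution M 0 <-> PGF M.
Proof.
split=> [[Q [d [e [QPGF Q0 esurj ed _]]]]|MPGF].
  have [P [Pproj Pac Pten [n [j jinj jran]]]] := QPGF 0 isT.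
  (* Since [Q 1] is zero, exactness at [Q 0] makes [e] an isomorphism, and M is a syzygy of the same
     complex as [Q 0]. *)
  have einj x y : e x = e y -> x = y.
    move=> exy; apply/eqP; rewrite -subr_eq0; apply/eqP.
    have [z <-] : exists z, d 0 z = x - y.
      by apply/ed; rewrite linearB exy subrr.
    by rewrite (Q0 1 isT z) linear0.
  have /choice[e' e'K] := esurj.
  have e'L : linear e'.
    by move=> a x y; apply: einj; rewrite linearP !e'K.
  exists P; split=> //; exists n, (j \o to_linear e'L).
    by move=> x y /jinj /(congr1 e); rewrite !e'K.
  rewrite -jran; apply/seteqP; split=> [_ [x _ <-]|_ [x _ <-]].
    by exists (e' x).
  by exists (e x) => //=; congr (j _); apply: einj; rewrite e'K.
have idL : linear (@idfun M) by [].
exists (trunc_obj M), (fun k => \0), (to_linear idL); split.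
- by case.
- by case=> // k _ x; apply/matrixP => - [].
- by move=> y; exists y.
- by move=> y; split=> [y0|[x <-] //]; exists 0; exact/esym/y0.
- move=> k y; split=> // _; exists 0.
  by rewrite linear0; symmetry; apply/matrixP => - [].
Qed.

Lemma PGF_dim0 (M : lmodType S) : PGF_dim M = Some 0 <-> PGF M.
Proof.
rewrite -PGF_resolution0 /PGF_dim; case: pselect => [ex|nex]; last first.
  by split=> // res0; case: nex; exists 0; apply/asboolP.
case: ex_minnP => m /asboolP resm m_min; split=> [[m0]|res0].
  by rewrite m0 in resm.
by congr Some; apply/eqP; rewrite -leqn0 m_min //; apply/asboolP.
Qed.

End PGFDimension.

(** * Finiteness from an invariant element *)

(** P is a retract of the free module on its own elements; the section sends x to a nonzero element,
    and [f] is one of its nonzero coordinates. *)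
Lemma projective_torsionless (S : nzRingType) (P : lmodType S) (x : P) :
  projective_module P -> x != 0 ->
  exists2 f : P -> S, (forall s y, f (s *: y) = s * f y) & f x != 0.
Proof.
move=> projP xn0.
have fib : fiberwise_additive (fun (y : P) (s : S) => s *: y).
  by move=> y s t; rewrite scalerDl.
pose q (a : {malg S[P]}) : P := malg_lift (fun y s => s *: y) a.
have qL : linear q.
  move=> s a b; rewrite /q (malg_liftD fib); congr (_ + _).
  rewrite (malg_liftEw fib (msuppZ_le s a)) scaler_sumr.
  by apply: eq_bigr => y _; rewrite mcoeffZ scalerA.
have idL : linear (@idfun P) by [].
have [y|h hK] := projP _ _ (to_linear qL) (to_linear idL).
  by exists << 1 *g y >>; rewrite /= /q (malg_liftU _ _ fib) scale1r.
have hxn0 : h x != 0.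
  apply: contra_neq xn0 => hx0; have <- : q (h x) = x := hK x.
  by rewrite hx0; exact: linear0 (to_linear qL).
have [y hxy] : exists y, (h x)@_y != 0.
  apply: contrapT => hx0; case/eqP: hxn0; apply/malgP => y; rewrite mcoeff0.
  by apply/eqP/negP => /negP hy; apply: hx0; exists y.
by exists (fun z => (h z)@_y) => // s z; rewrite linearZ mcoeffZ.
Qed.

Section NontrivialGroupRing.
Variables (R : comNzRingType) (G : groupType).
Local Notation S := (group_ring R G).

(** The augmentation separates 1 from 0. This provides the nonzero ring structure for
    [projective_torsionless]. *)
Lemma group_ring_oner_neq0 : (1 : S) != 0.
Proof.
apply: contra_neq (oner_neq0 R) => S10.
rewrite -(augmentation1 R G) S10 /augmentation /malg_lift.
by rewrite msupp0 big_seq_fset0.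
Qed.

HB.instance Definition _ :=
  GRing.PzSemiRing_isNonZero.Build (group_ring R G) group_ring_oner_neq0.

(** Invariance makes the coefficients of [c] constant on G; one of them is nonzero, so the finite
    support is all of G. *)
Lemma invariant_finite (c : S) :
  (forall g, (<< 1 *g g >> : S) * c = c) -> c != 0 ->
  finite_set [set: G]%classic.
Proof.
move=> cinv cn0.
have cmul g k : c@_(g * k)%g = c@_k.
  rewrite -[in LHS](cinv g).
  have fD (a b : S) : (a + b)@_(g * k)%g = a@_(g * k)%g + b@_(g * k)%g.
    exact: mcoeffD.
  (* What remains holds for every element: left multiplication by g shifts the coefficients by g. *)
  move: (c); apply: malg_additive_ext => [a b|a b|s h].
  - by rewrite mulrDr fD.
  - exact: mcoeffD.
  by rewrite [_ * _]gr_mulUU mul1r !mcoeffU (inj_eq (@mulgI _ g)).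
have [k ck] : exists k, c@_k != 0.
  apply: contrapT => c0; case/eqP: cn0; apply/malgP => y; rewrite mcoeff0.
  by apply/eqP/negP => /negP hy; apply: c0; exists y.
apply/finite_fsetP; exists (msupp c); apply/seteqP; split=> // g _ /=.
by rewrite -mcoeff_neq0 -[g](mulgVK k) cmul.
Qed.

(** The image of 1 in a projective term is nonzero and fixed by G; a functional that does not vanish
    there gives an invariant element of RG. *)
Lemma trivial_PGF_finite :
  PGF (trivial_module R G : lmodType S) -> finite_set [set: G]%classic.
Proof.
case=> P [Pproj _ _ [n [j jinj _]]].
have j1 : j (1 : R) != 0.
  rewrite -(linear0 j); apply: contra_neq (oner_neq0 R) => /jinj.
  exact.
have [f fZ] := projective_torsionless (Pproj n) j1.
apply: invariant_finite => g; rewrite -fZ -linearZ; congr (f (j _)).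
by rewrite trivial_gr_scale mulr1.
Qed.

End NontrivialGroupRing.

Theorem theorem3p3 (G : groupType) :
  (finite_set [set: G]%classic <->
     (forall R : comPzRingType, Gcd_tilde R G = Some 0%N)) /\
  ((forall R : comPzRingType, Gcd_tilde R G = Some 0%N) <->
     Gcd_tilde int G = Some 0%N).
Proof.
have finP : finite_set [set: G]%classic ->
    forall R : comPzRingType, Gcd_tilde R G = Some 0%N.
  move=> /finite_fsetP[X XE] R; apply/PGF_dim0; apply: (@trivial_PGF R G X).
  by move=> g; have : [set: G]%classic g by []; rewrite XE.
have Pfin : Gcd_tilde int G = Some 0%N -> finite_set [set: G]%classic.
  by move/PGF_dim0; exact: trivial_PGF_finite.
by split; split; auto.
Qed.
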